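(* Let $R$ be a commutative ring with identity. Let $\mathcal{M}',\mathcal{M},\mathcal{M}'',\mathcal{N}',\mathcal{N},\mathcal{N}''$ be complexes of $R$-modules, let $\phi:\mathcal{M}'\to\mathcal{M}$, $\psi:\mathcal{M}\to\mathcal{M}''$, $\phi':\mathcal{N}'\to\mathcal{N}$, $\psi':\mathcal{N}\to\mathcal{N}''$ and $\beta':\mathcal{M}'\to\mathcal{N}'$, $\beta:\mathcal{M}\to\mathcal{N}$, $\beta'':\mathcal{M}''\to\mathcal{N}''$ be maps of complexes. Assume that the diagram with rows $$0\to\mathcal{R}(\mathcal{M}')\xrightarrow{\mathcal{R}(\phi)}\mathcal{R}(\mathcal{M})\xrightarrow{\mathcal{R}(\psi)}\mathcal{R}(\mathcal{M}'')\to 0,\qquad 0\to\mathcal{R}(\mathcal{N}')\xrightarrow{\mathcal{R}(\phi')}\mathcal{R}(\mathcal{N})\xrightarrow{\mathcal{R}(\psi')}\mathcal{R}(\mathcal{N}'')\to 0$$ and vertical maps $\mathcal{R}(\beta'),\mathcal{R}(\beta),\mathcal{R}(\beta'')$ is commutative, i.e. $\mathcal{R}(\beta)\mathcal{R}(\phi)=\mathcal{R}(\phi')\mathcal{R}(\beta')$ and $\mathcal{R}(\beta'')\mathcal{R}(\psi)=\mathcal{R}(\psi')\mathcal{R}(\beta)$, and that both rows are exact sequences of complexes of $\mathcal{R}(R)$-semimodules such that for every positive integer $n$: the image of $\mathcal{R}(\phi_n)$ (resp. $\mathcal{R}(\phi'_n)$) is contained in the image of the $\mathcal{R}$-boundary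 map $\mathcal{R}(M_{n+1})\to\mathcal{R}(M_n)$ (resp. $\mathcal{R}(N_{n+1})\to\mathcal{R}(N_n)$), the image of the $\mathcal{R}$-boundary map $\mathcal{R}(M''_n)\to\mathcal{R}(M''_{n-1})$ (resp. $\mathcal{R}(N''_n)\to\mathcal{R}(N''_{n-1})$) is subtractive, and $\mathcal{R}(\psi_n)$ (resp. $\mathcal{R}(\psi'_n)$) is steady. Let $\alpha_n:H_n(\mathcal{R}(\mathcal{M}''))\to H_{n-1}(\mathcal{R}(\mathcal{M}'))$ and $\alpha'_n:H_n(\mathcal{R}(\mathcal{N}''))\to H_{n-1}(\mathcal{R}(\mathcal{N}'))$ be the connecting homomorphisms of the resulting long exact homology sequences. Then the induced diagram between the two long exact homology sequences $$\cdots\to H_n(\mathcal{R}(\mathcal{M}'))\xrightarrow{H_n(\mathcal{R}(\phi))}H_n(\mathcal{R}(\mathcal{M}))\xrightarrow{H_n(\mathcal{R}(\psi))}H_n(\mathcal{R}(\mathcal{M}''))\xrightarrow{\alpha_n}H_{n-1}(\mathcal{R}(\mathcal{M}'))\to\cdots$$ $$\cdots\to H_n(\mathcal{R}(\mathcal{N}'))\xrightarrow{H_n(\mathcal{R}(\phi'))}H_n(\mathcal{R}(\mathcal{N}))\xrightarrow{H_n(\mathcal{R}(\psi'))}H_n(\mathcal{R}(\mathcal{N}''))\xrightarrow{\alpha'_n}H_{n-1}(\mathcal{R}(\mathcal{N}'))\to\cdots$$ with vertical maps $H_n(\mathcal{R}(\beta'))$, $H_n(\mathcal{R}(\beta))$,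 $H_n(\mathcal{R}(\beta''))$ is commutative; that is, $H_n(\mathcal{R}(\beta))H_n(\mathcal{R}(\phi))=H_n(\mathcal{R}(\phi'))H_n(\mathcal{R}(\beta'))$, $H_n(\mathcal{R}(\beta''))H_n(\mathcal{R}(\psi))=H_n(\mathcal{R}(\psi'))H_n(\mathcal{R}(\beta))$ and $H_{n-1}(\mathcal{R}(\beta'))\,\alpha_n=\alpha'_n\,H_n(\mathcal{R}(\beta''))$ in all degrees.
   Context: For an $R$-module $M$ and a submodule $N\subseteq M$, $\operatorname{rad}(N)$ is the intersection of all prime submodules of $M$ containing $N$ (and $\operatorname{rad}(N)=M$ if there is none); a submodule $P\subsetneq M$ is prime if $rm\in P$ ($r\in R$, $m\in M$) implies $m\in P$ or $rM\subseteq P$. $N$ is a radical submodule if $\operatorname{rad}(N)=N$. For an ideal $I$ of $R$, $\sqrt I$ is its usual radical. $\mathcal{R}(R)$ is the set of radical ideals of $R$, a commutative semiring with sum $\sqrt{I+J}$ and product $\sqrt{IJ}$. $\mathcal{R}(M)$ is the set of radical submodules of $M$, an $\mathcal{R}(R)$-semimodule with addition $\operatorname{rad}(N+L)$ and scalar action $\operatorname{rad}(IN)$; its zero element is $\operatorname{rad}(0)$. (A semimodule over a commutative semiring is a commutative monoid with an action satisfying the usual unital module axioms, with $r0=0$ and $0m=0$.) For an $R$-module homomorphism $f:M\to M'$, $\mathcal{R}(f):\mathcal{R}(M)\to\mathcal{R}(M')$ is the $\mathcal{R}(R)$-semimodule homomorphism $\mathcal{R}(f)(N)=\operatorname{rad}(f(N))$.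 It is known that $\mathcal{R}$ is a covariant functor from $R$-modules to $\mathcal{R}(R)$-semimodules. A complex $\mathcal{M}=(M_n,f_n)_{n\ge 0}$ of $R$-modules is a sequence of modules with homomorphisms (boundary maps) $f_n:M_n\to M_{n-1}$ ($M_{-1}=0$) and $f_nf_{n+1}=0$ for all $n\geq 0$. A map of complexes is a family of homomorphisms in each degree commuting with the boundary maps. The ''$\mathcal{R}$-boundary map'' is $\mathcal{R}(f_n)$. The terms of $\mathcal{M}',\mathcal{M},\mathcal{M}'',\mathcal{N}',\mathcal{N},\mathcal{N}''$ are denoted $M'_n,M_n,M''_n,N'_n,N_n,N''_n$. $\mathcal{R}(\mathcal{M})=(\mathcal{R}(M_n),\mathcal{R}(f_n))_{n\ge 0}$ is a complex of $\mathcal{R}(R)$-semimodules, with $Z_n(\mathcal{R}(\mathcal{M}))=\operatorname{Ker}\mathcal{R}(f_n)$ (elements mapped to the zero element) and $B_n(\mathcal{R}(\mathcal{M}))=\operatorname{Im}\mathcal{R}(f_{n+1})\subseteq Z_n(\mathcal{R}(\mathcal{M}))$. For a subsemimodule $\mathsf{N}$ of a semimodule $\mathsf{M}$, the Bourne relation is $m\equiv_{\mathsf{N}}m'$ iff $m+n=m'+n'$ for some $n,n'\in\mathsf{N}$; the class of $m$ is $m/\mathsf{N}$, and the set of classes $\mathsf{M}/\mathsf{N}$ is a semimodule with the induced operations. The $n$-th radical homology is $H_n(\mathcal{R}(\mathcal{M}))=Z_n(\mathcal{R}(\mathcal{M}))/B_n(\mathcal{R}(\mathcal{M}))$. A map $\phi$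 of complexes of $R$-modules induces $H_n(\mathcal{R}(\phi))$ by $N/B_n\mapsto\operatorname{rad}(\phi_n(N))/B_n$. A sequence of semimodules and homomorphisms is exact if at each term the set-theoretic image of the incoming map equals the kernel of the outgoing map; a sequence of complexes is exact if it is exact in each degree $n\ge 0$. A subsemimodule $\mathsf{N}$ of $\mathsf{M}$ is subtractive if $m\in\mathsf{M}$, $n\in\mathsf{N}$ and $m+n\in\mathsf{N}$ imply $m\in\mathsf{N}$. A semimodule homomorphism $g$ is steady if $g(m)=g(m')$ implies $m+k=m'+k'$ for some $k,k'\in\operatorname{Ker} g$. Connecting homomorphism: under the stated hypotheses on a row, a previous theorem of the paper gives $\mathcal{R}(R)$-semimodule homomorphisms $\alpha_n:H_n(\mathcal{R}(\mathcal{M}''))\to H_{n-1}(\mathcal{R}(\mathcal{M}'))$ making the long homology sequence exact; $\alpha_n$ is the snake-lemma connecting map: $\alpha_n(N''/B_n(\mathcal{R}(\mathcal{M}'')))=N'/B_{n-1}(\mathcal{R}(\mathcal{M}'))$ whenever $N''\in Z_n(\mathcal{R}(\mathcal{M}''))$, $N\in\mathcal{R}(M_n)$ and $N'\in Z_{n-1}(\mathcal{R}(\mathcal{M}'))$ satisfy $\mathcal{R}(\psi_n)(N)=N''$ and $\mathcal{R}(f_n)(N)=\mathcal{R}(\phi_{n-1})(N')$ ($f_n$ being the boundary of $\mathcal{M}$). Similarly for $\alpha'_n$. *)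

(* Defs.v *)
From HB Require Import structures.
From mathcomp Require Import all_boot all_algebra.
From mathcomp Require Import boolp classical_sets.

Set Implicit Arguments.
Unset Strict Implicit.
Unset Printing Implicit Defensive.

Import GRing.Theory.
Local Open Scope classical_set_scope.
Local Open Scope quotient_scope.
Local Open Scope ring_scope.

Section Submodules.
Variables (R : comPzRingType) (M : lmodType R).
Implicit Types (I : set R) (N L P : set M).

Definition submodule N := N 0 /\ forall a x y, N x -> N y -> N (a *: x + y).

Definition prime_submodule P :=
  [/\ submodule P, P <> setT
    & forall r m, P (r *: m) -> P m \/ forall x, P (r *: x)].

(* The intersection over an empty family of primes is setT. *)
Definition rad N : set M :=
  [set x | forall P, prime_submodule P -> N `<=` P -> P x].

Definition sum_submod N L : set M := [set x + y | x in N & y in L].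

(* The submodule IN generated by the products of elements of I and N. *)
Definition mul_submod I N : set M :=
  [set x | forall L, submodule L ->
     (forall a m, I a -> N m -> L (a *: m)) -> L x].

End Submodules.

Section Ideals.
Variable R : comPzRingType.
Implicit Types I J : set R.

Definition ideal I := submodule (I : set R^o).
Definition sqrt_ideal I : set R := [set a | exists n : nat, I (a ^+ n)].
Definition sum_ideal I J : set R := sum_submod (I : set R^o) (J : set R^o).
Definition mul_ideal I J : set R := mul_submod I (J : set R^o).

End Ideals.

Record radIdeal (R : comPzRingType) := RadIdeal {
  radIdeal_set :> set R;
  radIdeal_ideal : ideal radIdeal_set;
  radIdeal_sqrt : sqrt_ideal radIdeal_set = radIdeal_set }.

Record radSubmod (R : comPzRingType) (M : lmodType R) := RadSubmod {
  radSubmod_set :> set M;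
  radSubmod_submod : submodule radSubmod_set;
  radSubmod_rad : rad radSubmod_set = radSubmod_set }.

HB.instance Definition _ (R : comPzRingType) := gen_eqMixin (radIdeal R).
HB.instance Definition _ (R : comPzRingType) := gen_choiceMixin (radIdeal R).
HB.instance Definition _ (R : comPzRingType) (M : lmodType R) :=
  gen_eqMixin (radSubmod M).
HB.instance Definition _ (R : comPzRingType) (M : lmodType R) :=
  gen_choiceMixin (radSubmod M).

Section SubmoduleTheory.
Variables (R : comPzRingType) (M : lmodType R).
Implicit Types (I J : set R) (N L P : set M).

Lemma submoduleD N x y : submodule N -> N x -> N y -> N (x + y).
Proof. by move=> [_ h] Nx Ny; rewrite -[x]scale1r; apply: h. Qed.

Lemma submoduleZ N a x : submodule N -> N x -> N (a *: x).
Proof. by move=> [N0 h] Nx; rewrite -[_ *: _]addr0; apply: h. Qed.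

Lemma submodule_set0 : submodule [set (0 : M)].
Proof. by split=> // a x y /= -> ->; rewrite scaler0 addr0. Qed.

Lemma submodule_sum N L :
  submodule N -> submodule L -> submodule (sum_submod N L).
Proof.
move=> [N0 hN] [L0 hL]; split; first by exists 0 => //; exists 0; rewrite ?addr0.
move=> a _ _ [x Nx [y Ly <-]] [x' Nx' [y' Ly' <-]].
exists (a *: x + x'); first exact: hN.
by exists (a *: y + y'); [exact: hL | rewrite scalerDr addrACA].
Qed.

Lemma submodule_mul I N : submodule (mul_submod I N).
Proof.
split=> [L [] //|a x y hx hy L sL hL].
by case: (sL) => _; apply; [apply: hx | apply: hy].
Qed.

Lemma sum_submod_sub N L P : submodule P -> N 0 -> L 0 ->
  sum_submod N L `<=` P <-> N `<=` P /\ L `<=` P.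
Proof.
move=> sP N0 L0; split=> [h|[hN hL] _ [x Nx [y Ly <-]]].
  split=> x Nx; apply: h.
    by exists x => //; exists 0; rewrite ?addr0.
  by exists 0 => //; exists x; rewrite ?add0r.
by apply: submoduleD => //; [apply: hN | apply: hL].
Qed.

Lemma mul_submod_sub I N P : submodule P ->
  mul_submod I N `<=` P <-> forall a m, I a -> N m -> P (a *: m).
Proof.
by move=> sP; split=> [h a m Ia Nm|h x]; [apply: h => L _; apply | apply].
Qed.

Lemma submodule_rad N : submodule (rad N).
Proof.
split=> [P [[P0 _] _ _] _ //|a x y hx hy P pP NP].
by case: (pP) => -[_ h] _ _; apply: h; [apply: hx | apply: hy].
Qed.

Lemma sub_rad N : N `<=` rad N.
Proof. by move=> x Nx P _; apply. Qed.

Lemma rad_sub_prime N P : prime_submodule P -> rad N `<=` P <-> N `<=` P.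
Proof.
by move=> pP; split=> [h x Nx|h x]; [apply: h; apply: sub_rad | move=> rx; apply: rx].
Qed.

Lemma eq_rad N L :
  (forall P, prime_submodule P -> N `<=` P <-> L `<=` P) -> rad N = rad L.
Proof.
move=> h; rewrite /rad; apply/seteqP; split=> x hx P pP sP.
  by apply: hx => //; apply/h.
by apply: hx => //; apply/h.
Qed.

Lemma radK N : rad (rad N) = rad N.
Proof. by apply: eq_rad => P; apply: rad_sub_prime. Qed.

Definition colon P : set R := [set a | forall m, P (a *: m)].

Lemma mul_submod_prime I N P : prime_submodule P ->
  mul_submod I N `<=` P <-> N `<=` P \/ I `<=` colon P.
Proof.
case=> sP _ pP; rewrite mul_submod_sub //; split=> [h|[h|h] a m Ia Nm].
- case: (pselect (N `<=` P)) => [|nNP]; [by left | right=> a Ia].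
  apply: contrapT => na; apply: nNP => m Nm.
  by case: (pP _ _ (h a m Ia Nm)).
- by apply: submoduleZ => //; apply: h.
- exact: h.
Qed.

Lemma colonX P a k : prime_submodule P -> colon P (a ^+ k) -> colon P a.
Proof.
case=> sP _ pP; elim: k => [|k IHk] h.
  by move=> m; apply: submoduleZ => //; have := h m; rewrite expr0 scale1r.
have [//|na] := pselect (colon P a).
by apply: IHk => m; have := h m; rewrite exprS -scalerA => /pP[].
Qed.

Lemma sqrt_sub_colon I P : prime_submodule P ->
  sqrt_ideal I `<=` colon P <-> I `<=` colon P.
Proof.
move=> pP; split=> h a; first by move=> Ia; apply: h; exists 1%N.
by case=> k /h; apply: colonX.
Qed.

Lemma submodule_colon P : submodule P -> submodule (colon P : set R^o).
Proof.
move=> sP; split=> [m|a x y hx hy m]; first by rewrite scale0r; case: sP.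
rewrite scalerDl; apply: submoduleD => //.
by rewrite -[a *: (x : R^o)]/(a * x) -scalerA; apply: submoduleZ.
Qed.

End SubmoduleTheory.

Lemma mul_ideal_sub_colon (R : comPzRingType) (M : lmodType R) (I J : set R) (P : set M) :
  prime_submodule P ->
  mul_ideal I J `<=` colon P <-> I `<=` colon P \/ J `<=` colon P.
Proof.
move=> pP; have [sP _ hP] := pP.
have E := @mul_submod_sub R R^o I J _ (submodule_colon sP).
split=> [/E h|h]; last by apply/E => a b Ia Jb m; case: h => h;
  rewrite -[a *: (b : R^o)]/(a * b) -scalerA;
  [exact: h | apply: submoduleZ => //; exact: h].
case: (pselect (I `<=` colon P)) => [|nI]; [by left | right=> b Jb m].
apply: contrapT => nb; apply: nI => a Ia.
by have := h a b Ia Jb m; rewrite -[a *: (b : R^o)]/(a * b) -scalerA => /hP[].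
Qed.

Lemma sum_ideal_sub_colon (R : comPzRingType) (M : lmodType R) (I J : set R) (P : set M) :
  prime_submodule P -> I 0 -> J 0 ->
  sum_ideal I J `<=` colon P <-> I `<=` colon P /\ J `<=` colon P.
Proof.
case=> sP _ _; exact: (@sum_submod_sub R R^o I J _ (submodule_colon sP)).
Qed.

Section IdealTheory.
Variable R : comPzRingType.
Implicit Types I J K : set R.

Lemma sub_sqrt I : I `<=` sqrt_ideal I.
Proof. by move=> a Ia; exists 1%N. Qed.

Lemma ideal_sum I (n : nat) (F : 'I_n -> R) :
  ideal I -> (forall i, I (F i)) -> I (\sum_i F i).
Proof.
move=> [I0 hI] h; apply: (big_ind I) => // x y Ix Iy.
exact: (@submoduleD R R^o).
Qed.

Lemma idealMl I a x : ideal I -> I x -> I (a * x).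
Proof. exact: (@submoduleZ R R^o). Qed.

Lemma ideal_sqrt I : ideal I -> ideal (sqrt_ideal I).
Proof.
move=> iI; split; first by exists 1%N; case: iI.
move=> a x y [n hx] [m hy]; exists (n + m)%N.
rewrite exprDn; apply: ideal_sum => // i; rewrite -mulr_natl.
apply: idealMl => //; have [le|lt] := leqP m i.
  by apply: idealMl => //; rewrite -(subnK le) exprD; apply: idealMl.
rewrite mulrC; apply: idealMl => //; rewrite -[a *: (x : R^o)]/(a * x) exprMn.
apply: idealMl => //; rewrite -addnBA 1?ltnW // addnC exprD.
exact: idealMl.
Qed.

Lemma sqrtK I : sqrt_ideal (sqrt_ideal I) = sqrt_ideal I.
Proof.
apply/seteqP; split; last exact: sub_sqrt.
by move=> a [n [m h]]; exists (n * m)%N; rewrite exprM.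
Qed.

Lemma ideal_sumI I J : ideal I -> ideal J -> ideal (sum_ideal I J).
Proof. exact: submodule_sum. Qed.

Lemma ideal_mulI I J : ideal (mul_ideal I J).
Proof. exact: submodule_mul. Qed.

Lemma ideal_set0 : ideal [set (0 : R)].
Proof. exact: submodule_set0. Qed.

Lemma ideal_setT : ideal [set: R].
Proof. by []. Qed.

Definition sqrt_radIdeal I (iI : ideal I) : radIdeal R :=
  RadIdeal (ideal_sqrt iI) (sqrtK I).

Implicit Types A B C : radIdeal R.

Lemma radIdeal_inj A B : (A : set R) = B -> A = B.
Proof.
case: A B => [A iA sA] [B iB sB] /= eAB; case: _ / eAB in iB sB *.
by congr RadIdeal; apply: Prop_irrelevance.
Qed.

Lemma radIdeal0 A : (A : set R) 0. Proof. by case: (radIdeal_ideal A). Qed.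

Lemma sqrt_sub I A : sqrt_ideal I `<=` A <-> I `<=` A.
Proof.
split=> h; first exact: subset_trans (@sub_sqrt I) h.
by move=> a [n /h An]; rewrite -radIdeal_sqrt; exists n.
Qed.

Lemma sum_ideal_sub I J A : I 0 -> J 0 ->
  sum_ideal I J `<=` A <-> I `<=` A /\ J `<=` A.
Proof. exact: (@sum_submod_sub R R^o I J A (radIdeal_ideal A)). Qed.

Lemma eq_radIdeal A B : (forall C, A `<=` C <-> B `<=` C) -> A = B.
Proof.
by move=> h; apply/radIdeal_inj/seteqP; split; apply/h.
Qed.

Definition ri0 : radIdeal R := sqrt_radIdeal ideal_set0.
Definition ri1 : radIdeal R := sqrt_radIdeal ideal_setT.
Definition riD A B : radIdeal R :=
  sqrt_radIdeal (ideal_sumI (radIdeal_ideal A) (radIdeal_ideal B)).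
Definition riM A B : radIdeal R := sqrt_radIdeal (ideal_mulI A B).

Lemma riD_sub A B C : riD A B `<=` C <-> A `<=` C /\ B `<=` C.
Proof. by rewrite /riD /= sqrt_sub sum_ideal_sub; try exact: radIdeal0. Qed.

Lemma riME A B : riM A B = A `&` B :> set R.
Proof.
apply/seteqP; split.
  rewrite subsetI; split; apply/sqrt_sub.
    apply/(@mul_submod_sub R R^o A B _ (radIdeal_ideal A)) => a b Aa Bb.
    rewrite -[a *: (b : R^o)]/(a * b) mulrC.
    by apply: idealMl => //; apply: radIdeal_ideal.
  apply/(@mul_submod_sub R R^o A B _ (radIdeal_ideal B)) => a b Aa Bb.
  by apply: idealMl => //; apply: radIdeal_ideal.
move=> a [Aa Ba]; exists 2%N => L _; exact.
Qed.

Lemma riDA : associative riD.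
Proof. by move=> A B C; apply: eq_radIdeal => D; rewrite !riD_sub; tauto. Qed.

Lemma riDC : commutative riD.
Proof. by move=> A B; apply: eq_radIdeal => D; rewrite !riD_sub; tauto. Qed.

Lemma ri0_sub A : ri0 `<=` A.
Proof. by rewrite /ri0 /= sqrt_sub => _ ->; apply: radIdeal0. Qed.

Lemma ri0D : left_id ri0 riD.
Proof.
move=> A; apply: eq_radIdeal => D; rewrite riD_sub.
by have := @ri0_sub D; tauto.
Qed.

Lemma riMA : associative riM.
Proof. by move=> A B C; apply: radIdeal_inj; rewrite !riME setIA. Qed.

Lemma riMC : commutative riM.
Proof. by move=> A B; apply: radIdeal_inj; rewrite !riME setIC. Qed.

Lemma ri1M : left_id ri1 riM.
Proof.
move=> A; apply: radIdeal_inj; rewrite riME.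
by apply/seteqP; split=> [a []//|a Aa]; split=> //; exists 0%N.
Qed.

Lemma ri0M : left_zero ri0 riM.
Proof.
move=> A; apply: radIdeal_inj; rewrite riME; apply/seteqP.
by split=> [a []//|a a0]; split=> //; apply: ri0_sub.
Qed.

Lemma riMDl : left_distributive riM riD.
Proof.
move=> A B C; apply: radIdeal_inj; apply/seteqP; split; last first.
  by apply/riD_sub; rewrite !riME; split; apply: setSI;
    have [] := (riD_sub A B (riD A B)).1 (fun _ => id).
move=> a; rewrite riME => -[[n [i Ai [j Bj eij]]] Ca]; exists n.+1.
exists (a * i); last exists (a * j).
- rewrite riME; split; first by apply: idealMl => //; apply: radIdeal_ideal.
  by rewrite mulrC; apply: idealMl => //; apply: radIdeal_ideal.
- rewrite riME; split; first by apply: idealMl => //; apply: radIdeal_ideal.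
  by rewrite mulrC; apply: idealMl => //; apply: radIdeal_ideal.
by rewrite -mulrDr exprS -eij.
Qed.

End IdealTheory.

(* The commutative semiring of radical ideals:
   I + J is the radical of the sum, I * J the radical of the product. *)
HB.instance Definition _ (R : comPzRingType) :=
  GRing.isNmodule.Build (radIdeal R) (@riDA R) (@riDC R) (@ri0D R).
HB.instance Definition _ (R : comPzRingType) :=
  GRing.Nmodule_isComPzSemiRing.Build (radIdeal R)
    (@riMA R) (@riMC R) (@ri1M R) (@riMDl R) (@ri0M R).

Section RadSubmodTheory.
Variables (R : comPzRingType) (M : lmodType R).
Implicit Types (S : set M) (N L K : radSubmod M) (A B : radIdeal R).

Definition rad_radSubmod S : radSubmod M :=
  RadSubmod (submodule_rad S) (radK S).

Lemma radSubmod_inj N L : (N : set M) = L -> N = L.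
Proof.
case: N L => [N sN rN] [L sL rL] /= eNL; case: _ / eNL in sL rL *.
by congr RadSubmod; apply: Prop_irrelevance.
Qed.

Lemma radSubmod0 N : (N : set M) 0. Proof. by case: (radSubmod_submod N). Qed.

Lemma eq_radSubmod N L :
  (forall P, prime_submodule P -> N `<=` P <-> L `<=` P) -> N = L.
Proof.
move=> h; apply: radSubmod_inj.
by rewrite -(radSubmod_rad N) -(radSubmod_rad L); apply: eq_rad.
Qed.

Definition rs0 : radSubmod M := rad_radSubmod [set 0].
Definition rsD N L : radSubmod M := rad_radSubmod (sum_submod N L).
Definition rsZ A N : radSubmod M := rad_radSubmod (mul_submod A N).

Lemma rs0_sub P : prime_submodule P -> rs0 `<=` P <-> True.
Proof.
move=> pP; rewrite rad_sub_prime //; split=> // _ _ ->.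
by case: pP => -[].
Qed.

Lemma rsD_sub N L P : prime_submodule P ->
  rsD N L `<=` P <-> N `<=` P /\ L `<=` P.
Proof.
move=> pP; rewrite rad_sub_prime // sum_submod_sub //; try exact: radSubmod0.
by case: pP.
Qed.

Lemma rsZ_sub A N P : prime_submodule P ->
  rsZ A N `<=` P <-> N `<=` P \/ A `<=` colon P.
Proof. by move=> pP; rewrite rad_sub_prime // mul_submod_prime. Qed.

Lemma rsDA : associative rsD.
Proof.
by move=> N L K; apply: eq_radSubmod => P pP; rewrite !rsD_sub //; tauto.
Qed.

Lemma rsDC : commutative rsD.
Proof.
by move=> N L; apply: eq_radSubmod => P pP; rewrite !rsD_sub //; tauto.
Qed.

Lemma rs0D : left_id rs0 rsD.
Proof.
by move=> N; apply: eq_radSubmod => P pP; rewrite rsD_sub // rs0_sub //; tauto.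
Qed.

HB.instance Definition _ :=
  GRing.isNmodule.Build (radSubmod M) rsDA rsDC rs0D.

Lemma rsZA A B N : rsZ A (rsZ B N) = rsZ (A * B) N.
Proof.
apply: eq_radSubmod => P pP; rewrite !rsZ_sub //.
have -> : (A * B : set R) = sqrt_ideal (mul_ideal A B) by [].
by rewrite sqrt_sub_colon // mul_ideal_sub_colon //; tauto.
Qed.

Lemma rsZ0 N : rsZ 0 N = 0.
Proof.
apply: eq_radSubmod => P pP; rewrite rs0_sub // rsZ_sub //.
split=> // _; right; apply/(sqrt_sub_colon _ pP) => _ -> m.
by rewrite scale0r; case: pP => -[].
Qed.

Lemma rsZ1 : left_id 1 rsZ.
Proof.
move=> N; apply: eq_radSubmod => P pP; rewrite rsZ_sub //; split; last by left.
case=> // h; case: (pP) => _ neP _; case: neP.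
apply/seteqP; split=> // m _; rewrite -[m]scale1r; apply: h.
by exists 0%N.
Qed.

Lemma rsZDr : right_distributive rsZ +%R.
Proof.
move=> A N L; apply: eq_radSubmod => P pP.
by rewrite rsZ_sub // !rsD_sub // !rsZ_sub //; tauto.
Qed.

Lemma rsZDl N : {morph rsZ^~ N : A B / A + B}.
Proof.
move=> A B; apply: eq_radSubmod => P pP.
rewrite rsD_sub // !rsZ_sub //.
have -> : (A + B : set R) = sqrt_ideal (sum_ideal A B) by [].
rewrite sqrt_sub_colon //.
rewrite sum_ideal_sub_colon //; try exact: radIdeal0; tauto.
Qed.

HB.instance Definition _ := GRing.Nmodule_isLSemiModule.Build
  (radIdeal R) (radSubmod M) rsZA rsZ0 rsZ1 rsZDr rsZDl.

End RadSubmodTheory.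

Section Functor.
Variables (R : comPzRingType) (M M' : lmodType R) (f : {linear M -> M'}).

Definition rad_map (N : radSubmod M) : radSubmod M' :=
  rad_radSubmod [set f x | x in (N : set M)].

Lemma rad_preimage (N : set M) P : prime_submodule P ->
  rad N `<=` f @^-1` P <-> N `<=` f @^-1` P.
Proof.
move=> [[P0 hP] neP pP]; split=> h; first exact: subset_trans (@sub_rad _ _ N) h.
have [->//|nfP] := pselect (f @^-1` P = setT).
apply: subset_trans (subset_refl _) => x hx; apply: hx => //; split=> //.
  split=> [|a y z] /=; first by rewrite raddf0.
  by rewrite linearP; apply: hP.
move=> r m; rewrite /= linearZ => /pP[|h']; [by left | right=> y].
by rewrite linearZ; apply: h'.
Qed.

Lemma rad_map_sub N P : prime_submodule P ->
  rad_map N `<=` P <-> N `<=` f @^-1` P.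
Proof. by move=> pP; rewrite rad_sub_prime // image_subP. Qed.

Lemma submodule_preimage P : submodule P -> submodule (f @^-1` P).
Proof.
move=> [P0 hP]; split=> [|a y z] /=; first by rewrite raddf0.
by rewrite linearP; apply: hP.
Qed.

Lemma rad_map_semilinear : GRing.semilinear_for *:%R rad_map.
Proof.
split=> [A N|N L]; apply: eq_radSubmod => P pP.
  have [sP _ _] := pP; have sfP := submodule_preimage sP.
  rewrite rad_map_sub // rad_preimage // mul_submod_sub //.
  rewrite rsZ_sub // rad_sub_prime // -mul_submod_prime // mul_submod_sub //.
  split=> h a m Aa; first by case=> x Nx <-; rewrite -linearZ; apply: h.
  by move=> Nm; rewrite /= linearZ; apply: h => //; exists m.
have [sP _ _] := pP; have sfP := submodule_preimage sP.
rewrite rad_map_sub // rad_preimage // sum_submod_sub //; try exact: radSubmod0.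
by rewrite rsD_sub // !rad_map_sub.
Qed.

HB.instance Definition _ := GRing.isSemilinear.Build
  (radIdeal R) (radSubmod M) (radSubmod M') *:%R rad_map rad_map_semilinear.

End Functor.

Lemma rad_map_comp_sub (R : comPzRingType) (A B C : lmodType R)
    (f : {linear A -> B}) (g : {linear B -> C}) N P : prime_submodule P ->
  rad_map g (rad_map f N) `<=` P <-> N `<=` (g \o f) @^-1` P.
Proof.
move=> pP; rewrite rad_map_sub //; apply: iff_trans (rad_preimage _ _ pP) _.
by rewrite image_subP.
Qed.

Lemma rad_map_square (R : comPzRingType) (A B C D : lmodType R)
    (f : {linear A -> B}) (g : {linear B -> D})
    (h : {linear A -> C}) (k : {linear C -> D}) :
  (forall x, g (f x) = k (h x)) ->
  forall N, rad_map g (rad_map f N) = rad_map k (rad_map h N).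
Proof.
move=> e N; apply: eq_radSubmod => P pP.
rewrite !rad_map_comp_sub //.
by split=> H x /H; rewrite /= e.
Qed.

Lemma rad_map_zero (R : comPzRingType) (A B C : lmodType R)
    (f : {linear A -> B}) (g : {linear B -> C}) :
  (forall x, g (f x) = 0) -> forall N, rad_map g (rad_map f N) = 0.
Proof.
move=> e N; apply: eq_radSubmod => P pP.
rewrite rs0_sub // rad_map_comp_sub //.
by split=> // _ x _; rewrite /= e; case: pP => -[].
Qed.

Section Semimodules.
Variables (K : pzSemiRingType).

Definition kernel (A B : nmodType) (f : A -> B) : set A := [set x | f x = 0].

(* Exactness of 0 -> A -> B -> C -> 0. *)
Definition short_exact (A B C : nmodType) (f : A -> B) (g : B -> C) :=
  [/\ kernel f = [set 0], range f = kernel g & range g = setT].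

Definition subtractive (A : nmodType) (N : set A) :=
  forall m n, N n -> N (m + n) -> N m.

Definition steady (A B : nmodType) (f : A -> B) :=
  forall m m', f m = f m' ->
    exists k k', [/\ kernel f k, kernel f k' & m + k = m' + k'].

Section KernelSemimodule.
Variables (A B : lSemiModType K) (f : {linear A -> B}).

Definition kernel_pred : {pred A} := fun x => f x == 0.

Lemma kernel_closed : GRing.subsemimod_closed kernel_pred.
Proof.
split=> [|a x /eqP fx]; last by apply/eqP; rewrite linearZ_LR fx scaler0.
split=> [|x y /eqP fx /eqP fy]; first by apply/eqP; rewrite raddf0.
by apply/eqP; rewrite linearD fx fy addr0.
Qed.

HB.instance Definition _ :=
  GRing.isSubSemiModClosed.Build K A kernel_pred kernel_closed.

Record kernelType := KernelType {
  kernel_val : A; kernel_valP : kernel_val \in kernel_pred }.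

HB.instance Definition _ := [isSub for kernel_val].
HB.instance Definition _ := [Choice of kernelType by <:].
HB.instance Definition _ :=
  GRing.SubChoice_isSubLSemiModule.Build K A kernel_pred kernelType
    kernel_closed.

End KernelSemimodule.

Section BourneQuotient.
Variables (A : lSemiModType K) (N : submodClosed A).

Definition bourne : rel A := fun m m' =>
  `[< exists n n', [/\ n \in N, n' \in N & m + n = m' + n'] >].

Lemma bourne_refl : reflexive bourne.
Proof. by move=> m; apply/asboolP; exists 0, 0; rewrite rpred0. Qed.

Lemma bourne_sym : symmetric bourne.
Proof.
by move=> m m'; apply/asboolP/asboolP => -[n [n' [Nn Nn' e]]]; exists n', n.
Qed.

Lemma bourne_trans : transitive bourne.
Proof.
move=> y x z /asboolP[n [n' [Nn Nn' e]]] /asboolP[p [p' [Np Np' e']]].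
apply/asboolP; exists (n + p), (p' + n'); split; try exact: rpredD.
by rewrite addrA e addrAC e' addrA.
Qed.

Canonical bourne_equiv := EquivRel bourne bourne_refl bourne_sym bourne_trans.

Definition bourne_quot := {eq_quot bourne}.
HB.instance Definition _ : EqQuotient A bourne bourne_quot :=
  EqQuotient.on bourne_quot.
HB.instance Definition _ := Choice.on bourne_quot.

Lemma bourne_eqP x y :
  reflect (exists n n', [/\ n \in N, n' \in N & x + n = y + n'])
    (\pi_bourne_quot x == \pi_bourne_quot y).
Proof. by rewrite piE; apply: asboolP. Qed.

Definition bourne_pi (x : A) : bourne_quot := \pi_bourne_quot x.

Lemma bourne_reprP x :
  exists n n', [/\ n \in N, n' \in N & repr (bourne_pi x) + n = x + n'].
Proof. by apply/bourne_eqP; rewrite reprK. Qed.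

Lemma bourne_piP x y :
  (exists n n', [/\ n \in N, n' \in N & x + n = y + n']) ->
  bourne_pi x = bourne_pi y.
Proof. by move=> h; apply/eqP/bourne_eqP. Qed.

Definition bq0 : bourne_quot := bourne_pi 0.
Definition bqD (x y : bourne_quot) := bourne_pi (repr x + repr y).
Definition bqZ (a : K) (x : bourne_quot) := bourne_pi (a *: repr x).

Lemma bqDE x y : bqD (bourne_pi x) (bourne_pi y) = bourne_pi (x + y).
Proof.
have [n [n' [Nn Nn' e]]] := bourne_reprP x.
have [p [p' [Np Np' e']]] := bourne_reprP y.
apply: bourne_piP; exists (n + p), (n' + p'); split; try exact: rpredD.
by rewrite addrACA e e' addrACA.
Qed.

Lemma bqZE a x : bqZ a (bourne_pi x) = bourne_pi (a *: x).
Proof.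
have [n [n' [Nn Nn' e]]] := bourne_reprP x.
apply: bourne_piP; exists (a *: n), (a *: n'); split; try exact: rpredZ.
by rewrite -!scalerDr e.
Qed.

Lemma bourne_quotW (P : bourne_quot -> Prop) :
  (forall x, P (bourne_pi x)) -> forall x, P x.
Proof. by move=> h x; rewrite -[x]reprK; apply: h. Qed.

Lemma bqDA : associative bqD.
Proof.
do 3 elim/bourne_quotW => ?.
by rewrite !bqDE addrA.
Qed.

Lemma bqDC : commutative bqD.
Proof. by do 2 elim/bourne_quotW => ?; rewrite !bqDE addrC. Qed.

Lemma bq0D : left_id bq0 bqD.
Proof. by elim/bourne_quotW => ?; rewrite bqDE add0r. Qed.

HB.instance Definition _ := GRing.isNmodule.Build bourne_quot bqDA bqDC bq0D.

Lemma bqZA a b x : bqZ a (bqZ b x) = bqZ (a * b) x.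
Proof. by elim/bourne_quotW: x => ?; rewrite !bqZE scalerA. Qed.

Lemma bqZ0 x : bqZ 0 x = 0.
Proof. by elim/bourne_quotW: x => ?; rewrite bqZE scale0r. Qed.

Lemma bqZ1 : left_id 1 bqZ.
Proof. by elim/bourne_quotW => ?; rewrite bqZE scale1r. Qed.

Lemma bqZDr : right_distributive bqZ +%R.
Proof.
move=> a; do 2 elim/bourne_quotW => ?.
by rewrite [in RHS]bqZE [in RHS]bqZE [RHS]bqDE [X in bqZ _ X]bqDE bqZE
  scalerDr.
Qed.

Lemma bqZDl x : {morph bqZ^~ x : a b / a + b}.
Proof.
elim/bourne_quotW: x => x a b.
by rewrite bqZE scalerDl !bqZE [RHS]bqDE.
Qed.

HB.instance Definition _ := GRing.Nmodule_isLSemiModule.Build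
  K bourne_quot bqZA bqZ0 bqZ1 bqZDr bqZDl.

Lemma bourne_pi_semilinear : GRing.semilinear_for *:%R bourne_pi.
Proof. by split=> [a x|x y]; [rewrite [RHS]bqZE | rewrite [RHS]bqDE]. Qed.

HB.instance Definition _ := GRing.isSemilinear.Build
  K A bourne_quot *:%R bourne_pi bourne_pi_semilinear.

End BourneQuotient.

Section BourneQuotientMap.
Variables (A B : lSemiModType K) (N : submodClosed A) (L : submodClosed B).
Variables (f : {linear A -> B}).

Definition bourne_map of {in N, forall x, f x \in L} :
    bourne_quot N -> bourne_quot L :=
  fun x => bourne_pi L (f (repr x)).

Variable fN : {in N, forall x, f x \in L}.

Lemma bourne_mapE x :
  bourne_map fN (bourne_pi N x) = bourne_pi L (f x).
Proof.
have [n [n' [Nn Nn' e]]] := bourne_reprP N x.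
apply: bourne_piP; exists (f n), (f n'); split; try exact: fN.
by rewrite -!linearD e.
Qed.

Lemma bourne_map_semilinear : GRing.semilinear_for *:%R (bourne_map fN).
Proof.
split=> [a|]; first elim/bourne_quotW => x.
  by rewrite -linearZ_LR !bourne_mapE !linearZ_LR.
do 2 elim/bourne_quotW => ?.
by rewrite -linearD !bourne_mapE !linearD.
Qed.

HB.instance Definition _ := GRing.isSemilinear.Build
  K (bourne_quot N) (bourne_quot L) *:%R (bourne_map fN) bourne_map_semilinear.

End BourneQuotientMap.
End Semimodules.

Section Complexes.
Variable R : comPzRingType.

Record complex := Complex {
  cpx_obj :> nat -> lmodType R;
  cpx_diff : forall n, {linear cpx_obj n.+1 -> cpx_obj n};
  cpx_diffK : forall n x, cpx_diff n (cpx_diff n.+1 x) = 0 }.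

Record complex_map (C D : complex) := ComplexMap {
  cpx_map :> forall n, {linear C n -> D n};
  cpx_mapC : forall n x,
    cpx_map n (cpx_diff C n x) = cpx_diff D n (cpx_map n.+1 x) }.

(* The boundary map in degree n is [boundary C n : C n -> C (n - 1)], where the
   module in degree -1 is the zero module. *)
Definition cpx_prev (C : complex) (n : nat) : lmodType R :=
  if n is m.+1 then C m else 'rV[R]_0.

Definition boundary (C : complex) (n : nat) : {linear C n -> cpx_prev C n} :=
  match n with 0 => \0 | m.+1 => cpx_diff C m end.

Definition rad_boundary (C : complex) (n : nat) :
    {linear radSubmod (C n) -> radSubmod (cpx_prev C n)} :=
  rad_map (boundary C n).

Definition rad_cpx_map (C D : complex) (f : complex_map C D) (n : nat) :
    {linear radSubmod (C n) -> radSubmod (D n)} :=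
  rad_map (f n).

Definition cycles (C : complex) (n : nat) := kernelType (rad_boundary C n).

Section Homology.
Variables (C : complex) (n : nat).

Definition boundaries : {pred cycles C n} :=
  fun z => kernel_val z \in range (rad_boundary C n.+1).

Lemma boundaries_closed : GRing.subsemimod_closed boundaries.
Proof.
split=> [|a z /set_mem[N _ e]]; last first.
  by apply/mem_set; exists (a *: N) => //; rewrite linearZ_LR e.
split; first by apply/mem_set; exists 0; rewrite ?linear0.
move=> z w /set_mem[N _ e] /set_mem[L _ e']; apply/mem_set.
by exists (N + L) => //; rewrite linearD e e'.
Qed.

HB.instance Definition _ := GRing.isSubSemiModClosed.Build
  (radIdeal R) (cycles C n) boundaries boundaries_closed.

Definition homology : lSemiModType (radIdeal R) := bourne_quot boundaries.

Definition homology_class : {linear cycles C n -> homology} :=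
  bourne_pi boundaries.

End Homology.
Arguments boundaries C n z : clear implicits.

Section HomologyMap.
Variables (C D : complex) (f : complex_map C D).

Lemma rad_cpx_mapC n N :
  rad_boundary D n.+1 (rad_cpx_map f n.+1 N) =
  rad_cpx_map f n (rad_boundary C n.+1 N).
Proof. by apply: rad_map_square => x; rewrite /= cpx_mapC. Qed.

Lemma rad_cpx_map_cycle n (z : cycles C n) :
  rad_cpx_map f n (kernel_val z) \in kernel_pred (rad_boundary D n).
Proof.
case: z => N /= /eqP zN; apply/eqP; case: n N zN => [|n] N zN.
  apply: eq_radSubmod => P pP; rewrite rs0_sub // rad_map_sub //=.
  by split=> // _ x _ /=; case: pP => -[].
by rewrite rad_cpx_mapC zN linear0.
Qed.

Definition cycles_map n (z : cycles C n) : cycles D n :=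
  KernelType (rad_cpx_map_cycle z).

Lemma cycles_map_semilinear n : GRing.semilinear_for *:%R (@cycles_map n).
Proof.
by split=> [a z|z w]; apply: val_inj; rewrite /= ?linearZ_LR ?linearD.
Qed.

HB.instance Definition _ n := GRing.isSemilinear.Build
  (radIdeal R) (cycles C n) (cycles D n) *:%R
  (@cycles_map n) (@cycles_map_semilinear n).

Lemma cycles_map_boundaries n :
  {in boundaries C n, forall z, cycles_map z \in boundaries D n}.
Proof.
move=> z /set_mem[N _ e]; apply/mem_set; exists (rad_cpx_map f n.+1 N) => //.
by rewrite rad_cpx_mapC e.
Qed.

Definition homology_map n : {linear homology C n -> homology D n} :=
  bourne_map (@cycles_map_boundaries n).

Lemma homology_mapE n z :
  homology_map n (homology_class C n z) = homology_class D n (cycles_map z).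
Proof. exact: bourne_mapE. Qed.

End HomologyMap.

(* The snake-lemma characterization of the connecting homomorphism
   H_{n+1}(C'') -> H_n(C') of the row C' -> C -> C''. *)
Definition connecting_hom (C' C C'' : complex)
    (phi : complex_map C' C) (psi : complex_map C C'') (n : nat)
    (alpha : {linear homology C'' n.+1 -> homology C' n}) :=
  forall (N'' : cycles C'' n.+1) (N : radSubmod (C n.+1)) (N' : cycles C' n),
    rad_cpx_map psi n.+1 N = kernel_val N'' ->
    rad_boundary C n.+1 N = rad_cpx_map phi n (kernel_val N') ->
    alpha (homology_class C'' n.+1 N'') = homology_class C' n N'.

Record admissible_row (C' C C'' : complex)
    (phi : complex_map C' C) (psi : complex_map C C'') : Prop := {
  row_exact : forall n, short_exact (rad_cpx_map phi n) (rad_cpx_map psi n);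
  row_image : forall n, (0 < n)%N ->
    range (rad_cpx_map phi n) `<=` range (rad_boundary C n.+1);
  row_subtractive : forall n, (0 < n)%N ->
    subtractive (range (rad_boundary C'' n));
  row_steady : forall n, (0 < n)%N -> steady (rad_cpx_map psi n) }.

End Complexes.

(* Main.v *)
(* The connecting maps are determined by their values on lifts: a cycle z of the
   quotient complex lifts to some L with boundary R(phi)(L').  Functoriality and
   the two commuting squares show that R(beta)(L) is a lift of R(beta'')(z), with
   boundary R(phi')(R(beta')(L')), so both composites send the class of z to the
   class of R(beta')(L'). *)

Require Import Defs.
From HB Require Import structures.
From mathcomp Require Import all_boot all_algebra.
From mathcomp Require Import boolp classical_sets.
Import GRing.Theory.
Local Open Scope ring_scope.

(** Serves degree 0, where the boundary map is [\0]: every prime submodule contains 0, so the image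
    adds no constraint. *)
Lemma rad_map0 (R : comPzRingType) (A B : lmodType R)
    (f : {linear A -> B}) : (forall x, f x = 0) -> forall N, rad_map f N = 0.
Proof.
move=> f0 N; apply: eq_radSubmod => P pP; rewrite rs0_sub // rad_map_sub //.
by split=> // _ x _ /=; rewrite f0; case: pP => -[].
Qed.

(** Diagram chase: surjectivity of R(psi) gives [N], and exactness in the middle pulls its boundary
    back along R(phi). *)
Lemma connecting_lift {R : comPzRingType} {C' C C'' : complex R}
    {phi : complex_map C' C} {psi : complex_map C C''} {n : nat}
    (N'' : cycles C'' n.+1) :
  (forall k, short_exact (rad_cpx_map phi k) (rad_cpx_map psi k)) ->
  exists (N : radSubmod (C n.+1)) (N' : cycles C' n),
    rad_cpx_map psi n.+1 N = kernel_val N'' /\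
    rad_boundary C n.+1 N = rad_cpx_map phi n (kernel_val N').
Proof.
move=> ex.
have [_ _ psi_onto] := ex n.+1.
have [_ phi_psi _] := ex n.
have [N _ psiN] : range (rad_cpx_map psi n.+1) (kernel_val N'').
  by rewrite psi_onto.
have [L _ phiL] : range (rad_cpx_map phi n) (rad_boundary C n.+1 N).
  (* R(psi) commutes with the boundary, and [N''] is a cycle. *)
  rewrite phi_psi /kernel /= -rad_cpx_mapC psiN.
  by have /eqP := kernel_valP N''.
have L_cycle : L \in kernel_pred (rad_boundary C' n).
  (* Degree 0 is separate, since no component of phi lies below it. *)
  apply/eqP; case: n N'' N psiN L phiL {psi_onto phi_psi}
    => [|m] N'' N psiN L phiL.
    exact: rad_map0.
  have [phi_inj _ _] := ex m.
  (* A trivial kernel, weaker than injectivity for semimodules, suffices: R(phi) sends the boundary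
     of [L] to the double boundary of [N], which is zero. *)
  suff : kernel (rad_cpx_map phi m) (rad_boundary C' m.+1 L) by rewrite phi_inj.
  rewrite /kernel /= -rad_cpx_mapC phiL.
  exact/rad_map_zero/cpx_diffK.
by exists N, (KernelType L_cycle).
Qed.

Theorem corollary4 (R : comPzRingType)
    (M' M M'' N' N N'' : complex R)
    (phi : complex_map M' M) (psi : complex_map M M'')
    (phi' : complex_map N' N) (psi' : complex_map N N'')
    (beta' : complex_map M' N') (beta : complex_map M N)
    (beta'' : complex_map M'' N'')
    (comm_left : forall n,
       rad_cpx_map beta n \o rad_cpx_map phi n
         =1 rad_cpx_map phi' n \o rad_cpx_map beta' n)
    (comm_right : forall n,
       rad_cpx_map beta'' n \o rad_cpx_map psi n
         =1 rad_cpx_map psi' n \o rad_cpx_map beta n)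
    (rowM : admissible_row phi psi) (rowN : admissible_row phi' psi')
    (alpha : forall n, {linear homology M'' n.+1 -> homology M' n})
    (alpha' : forall n, {linear homology N'' n.+1 -> homology N' n})
    (alphaP : forall n, connecting_hom phi psi (alpha n))
    (alphaP' : forall n, connecting_hom phi' psi' (alpha' n)) :
  [/\ forall n, homology_map beta n \o homology_map phi n
                  =1 homology_map phi' n \o homology_map beta' n,
      forall n, homology_map beta'' n \o homology_map psi n
                  =1 homology_map psi' n \o homology_map beta n
    & forall n, homology_map beta' n \o alpha n
                  =1 alpha' n \o homology_map beta'' n.+1].
Proof.
split=> n.
- elim/bourne_quotW => z; rewrite /= !homology_mapE.
  (* The square already commutes on cycles, before passing to Bourne classes. *)
  by congr (homology_class _ _ _); apply: val_inj; apply: comm_left.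
- elim/bourne_quotW => z; rewrite /= !homology_mapE.
  by congr (homology_class _ _ _); apply: val_inj; apply: comm_right.
elim/bourne_quotW => z.
have [L [L' [psiL dL]]] := connecting_lift z (row_exact rowM).
rewrite /= (alphaP n z L L' psiL dL) !homology_mapE; symmetry.
apply: (alphaP' n _ (rad_cpx_map beta n.+1 L)) => /=.
  by rewrite -psiL; symmetry; apply: comm_right.
by rewrite rad_cpx_mapC dL; apply: comm_left.
Qed.
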